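(* Let $q$ be a prime power and $G=\mathrm{AGL}_1(q)$ with Frobenius kernel $K$, and let $X$ be a normal subset of $G$. (1) If $\mathrm{CS}(G,X)$ has a subgroup perfect code $H\neq\{1\}$, then there exist a Frobenius complement $C=\langle c\rangle$ of $G$, positive integers $s,t$ with $q-1=st$ and $t>1$, and a left transversal $\{a_0,a_1,\dots,a_{s-1}\}$ of $\langle c^s\rangle$ in $C$ with $a_0\in\langle c^s\rangle\setminus\{1\}$, such that $X=\big(\bigcup_{i=1}^{s-1}a_i^{G}\big)\cup(K\setminus\{1\})$. (2) If $\mathrm{CS}(G,X)$ has a subgroup which is a total perfect code, then there exist a Frobenius complement $C=\langle c\rangle$ of $G$, positive integers $s,t$ with $q-1=st$ and $t>1$, and a left transversal $\{a_0,a_1,\dots,a_{s-1}\}$ of $\langle c^s\rangle$ in $C$ with $a_0\in\langle c^s\rangle\setminus\{1\}$, such that $X=\bigcup_{i=0}^{s-1}a_i^{G}$.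
   Context: $\mathrm{AGL}_1(q)$ is the group of affine maps $x\mapsto\alpha x+\beta$ ($\alpha\in\mathbb{F}_q^{*}$, $\beta\in\mathbb{F}_q$) of $\mathbb{F}_q$; it is a Frobenius group whose Frobenius kernel $K$ (the translations) is elementary abelian of order $q$ and whose Frobenius complements (point stabilizers) are cyclic of order $q-1$. $a^G$ is the conjugacy class of $a$. A subset $X$ of $G$ is normal if $g^{-1}Xg=X$ for all $g$; the Cayley sum graph $\mathrm{CS}(G,X)$ has vertex set $G$ with distinct $g,h$ adjacent iff $gh\in X$. A perfect code is an independent vertex set $C$ such that every vertex outside $C$ has exactly one neighbour in $C$; a total perfect code is a vertex set $C$ such that every vertex has exactly one neighbour in $C$.
   Formalization: The normal subset X is assumed not to contain the identity (both parts) and to be nonempty (part 1); without this the claim fails, e.g. q=3, X=K with H of order 2, or X empty with H=G. *)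

(* Defs.v *)
From HB Require Import structures.
From mathcomp Require Import all_boot all_algebra all_fingroup all_solvable.

Set Implicit Arguments.
Unset Strict Implicit.
Unset Printing Implicit Defensive.

Import GRing.Theory.

Section AffineGroup.

Variable F : finFieldType.

Definition AGL1 : {set {perm F}} :=
  [set f : {perm F} | [exists alpha : F, exists beta : F,
     (alpha != 0%R) && [forall x : F, f x == (alpha * x + beta)%R]]].

Lemma AGL1P (f : {perm F}) :
  reflect (exists alpha beta : F,
             alpha != 0%R /\ forall x, f x = (alpha * x + beta)%R)
          (f \in AGL1).
Proof.
rewrite inE; apply: (iffP existsP) => [[a /existsP[b /andP[a0 /forallP fE]]]|].
  by exists a, b; split=> // x; apply/eqP.
move=> [a [b [a0 fE]]]; exists a; apply/existsP; exists b.
by rewrite a0; apply/forallP=> x; apply/eqP.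
Qed.

(* (f * g)%g is "f then g" on permutations; this order is immaterial below,
   since g * h and h * g are conjugate and so lie in the same normal subsets. *)
Lemma AGL1_group_set : group_set AGL1.
Proof.
apply/group_setP; split.
  apply/AGL1P; exists 1%R, 0%R; split; first exact: oner_neq0.
  by move=> x; rewrite perm1 mul1r addr0.
move=> f g /AGL1P[a [b [a0 fE]]] /AGL1P[c [d [c0 gE]]]; apply/AGL1P.
exists (c * a)%R, (c * b + d)%R; split; first by rewrite mulf_neq0.
by move=> x; rewrite permM fE gE mulrDr mulrA addrA.
Qed.

Canonical AGL1_group := Group AGL1_group_set.

End AffineGroup.

Section PerfectCodes.

Variables (T : finType) (V : {set T}) (e : rel T).

Definition perfect_code (C : {set T}) : bool :=
  [&& C \subset V,
      [forall x in C, forall y in C, ~~ e x y]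
    & [forall x in V :\: C, #|[set y in C | e x y]| == 1]].

Definition total_perfect_code (C : {set T}) : bool :=
  (C \subset V) && [forall x in V, #|[set y in C | e x y]| == 1].

End PerfectCodes.

Section CayleySum.

Variable gT : finGroupType.

(* The adjacency relation of CS(G, X); the vertex set G is passed separately
   to perfect_code and total_perfect_code. *)
Definition cayley_sum (X : {set gT}) : rel gT :=
  [rel g h | (g != h) && ((g * h)%g \in X)].

Definition left_transversal (G H A : {set gT}) : bool :=
  is_transversal A (lcosets H G) G.

End CayleySum.

(* Main.v *)
(* Let [slope] be the linear coefficient of an affine map; it is a morphism
   onto the units of [F], with kernel the group of translations, which is [K].
   A conjugacy class of [AGL1 F] outside [K] is a full coset of [K], i.e. a
   fibre of [slope], while [K^#] is one class.  So a normal subset [X] without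
   [1] is a union of nontrivial cosets of [K], together with all or none of
   [K^#].  If a subgroup [H] is a (total) perfect code then every left coset of
   [H], except [H] itself in the non-total case where [X] misses [H], meets
   [X] exactly once.  If [x \in X] lies outside [K] and [1 != k \in H :&: K]
   then [x] and [x * k] are two elements of [X] in one coset of [H]; similar
   collisions show that [H :&: K = 1], and that [K^# \subset X] in the perfect
   case but [X :&: K = set0] in the total case.  Then [H] is abelian and a
   nontrivial element of [H] has a single fixed point, so [H] lies in a point
   stabiliser [C], and [X] is determined by [X :&: C], which is the required
   transversal of [H] in [C] (once an element of [H^#] is added, in the perfect case). *)
Require Import Defs.
From mathcomp Require Import all_boot all_algebra all_fingroup all_solvable.
From mathcomp Require Import ring.

Set Implicit Arguments.
Unset Strict Implicit.

Import GRing.Theory.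

Local Open Scope group_scope.

(** * Affine maps: conjugacy, point stabilisers and the Frobenius kernel *)

Section Slope.

Variable F : finFieldType.
Implicit Types (f g h : {perm F}) (p : F).

Notation G := (AGL1 F).

Definition slope f : F := (f 1 - f 0)%R.

Lemma AGL1E {f} (Gf : f \in G) x : f x = (slope f * x + f 0)%R.
Proof.
by case/AGL1P: Gf => a [b [_ fE]]; rewrite /slope !fE; ring.
Qed.

Lemma AGL1_exists (a b : F) :
  a != 0%R -> exists2 f, f \in G & forall x, f x = (a * x + b)%R.
Proof.
move=> a0; have inj : injective (fun x => a * x + b)%R.
  by move=> x y /addIr /(mulfI a0).
exists (perm inj); last by move=> x; rewrite permE.
by apply/AGL1P; exists a, b; split=> // x; rewrite permE.
Qed.

Lemma AGL1_slope {f a b} : (forall x, f x = (a * x + b)%R) -> slope f = a.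
Proof. by move=> fE; rewrite /slope !fE; ring. Qed.

Lemma slope_neq0 f : slope f != 0%R.
Proof. by rewrite subr_eq0 (inj_eq perm_inj) oner_neq0. Qed.

Lemma slope1 : slope 1 = 1%R.
Proof. by rewrite /slope !perm1 subr0. Qed.

Lemma slopeM : {in G &, {morph slope : f g / f * g >-> (f * g)%R}}.
Proof.
move=> f g Gf Gg; rewrite {1}/slope !permM (AGL1E Gg (f 1%R)) (AGL1E Gg (f 0%R)).
by rewrite /slope; ring.
Qed.

Lemma slopeV : {in G, {morph slope : f / f^-1 >-> (f^-1)%R}}.
Proof.
move=> f Gf; apply: (mulIf (slope_neq0 f)).
by rewrite -slopeM ?groupV // mulVg slope1 mulVf ?slope_neq0.
Qed.

(** Conjugating [f] by the translation by [b] keeps the slope and adds [(1 - slope f) * b] to the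
    constant term; this is solved for [b]. *)
Lemma conj_slope f g : f \in G -> g \in G -> slope f != 1%R ->
  slope g = slope f -> exists2 h, h \in G & g = f ^ h.
Proof.
move=> Gf Gg nf sg.
have n1 : (1 - slope f)%R != 0%R by rewrite subr_eq0 eq_sym.
have [h Gh hE] := AGL1_exists ((g 0 - f 0) / (1 - slope f))%R (oner_neq0 F).
exists h => //; apply: (canRL (mulKg h)); apply/permP=> x.
rewrite !permM !hE (AGL1E Gg (_ + _)%R) sg (AGL1E Gf x).
by field.
Qed.

(** Conjugation by the dilation of ratio [r] turns the translation by [f 0] into the one by
    [r * f 0], whence [r = g 0 / f 0]. *)
Lemma conj_translation f g : f \in G -> g \in G -> slope f = 1%R -> slope g = 1%R ->
  f != 1 -> g != 1 -> exists2 h, h \in G & g = f ^ h.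
Proof.
move=> Gf Gg sf sg.
have nz k : k \in G -> slope k = 1%R -> k != 1 -> k 0%R != 0%R.
  move=> Gk sk; apply: contraNneq => k0; apply/eqP/permP=> x.
  by rewrite perm1 (AGL1E Gk) sk k0 mul1r addr0.
move=> /(nz f Gf sf) f0 /(nz g Gg sg) g0.
have [|h Gh hE] := @AGL1_exists (g 0 / f 0)%R 0%R; first by rewrite mulf_neq0 ?invr_eq0.
exists h => //; apply: (canRL (mulKg h)); apply/permP=> x.
rewrite !permM !hE (AGL1E Gg (_ + _)%R) sg (AGL1E Gf x) sf.
by field.
Qed.

Lemma slope_fix f : f \in G -> slope f != 1%R -> exists p, f p = p.
Proof.
move=> Gf nf; exists (f 0 / (1 - slope f))%R.
rewrite (AGL1E Gf); field.
by rewrite subr_eq0 eq_sym.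
Qed.

Lemma slope_fix_uniq f p p' :
  f \in G -> slope f != 1%R -> f p = p -> f p' = p' -> p' = p.
Proof.
move=> Gf nf fp fp'; apply/eqP; rewrite -subr_eq0.
have n1 : (1 - slope f)%R != 0%R by rewrite subr_eq0 eq_sym.
have : ((1 - slope f) * (p' - p) = 0)%R.
  transitivity ((p' - f p') - (p - f p))%R; last by rewrite fp fp' !subrr.
  by rewrite (AGL1E Gf p) (AGL1E Gf p'); ring.
by move/eqP; rewrite mulf_eq0 (negPf n1).
Qed.

Notation stab p := 'C_G[p | 'P].

Lemma stabP p f : reflect (f \in G /\ f p = p) (f \in stab p).
Proof.
by apply: (iffP setIP) => [[Gf /astab1P]|[Gf fp]]; split=> //; apply/astab1P.
Qed.

Arguments stabP {p f}.

Lemma stab_slope p f : f \in stab p -> slope f = 1%R -> f = 1.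
Proof.
case/stabP=> Gf fp sf; apply/permP=> x; rewrite perm1.
move: fp; rewrite (AGL1E Gf p) (AGL1E Gf x) sf !mul1r => /(canRL (addKr p)) ->.
by rewrite addNr addr0.
Qed.

Lemma stab_ex p (a : F) : a != 0%R -> exists2 f, f \in stab p & slope f = a.
Proof.
move=> a0; have [f Gf fE] := AGL1_exists (p - a * p)%R a0.
exists f; last exact: AGL1_slope fE.
by apply/stabP; split=> //; rewrite fE; ring.
Qed.

Lemma stab_cyclic p : cyclic (stab p).
Proof.
apply: (@field_mul_group_cyclic _ _ _ slope).
  by move=> f g /stabP[Gf _] /stabP[Gg _]; exact: slopeM.
move=> f Cf; split; first exact: stab_slope Cf.
by move->; rewrite slope1.
Qed.

Lemma card_stab p : #|stab p| = #|F|.-1.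
Proof.
have inj : {in stab p &, injective slope}.
  move=> f g Cf Cg sfg; apply: (mulIg g^-1); rewrite mulgV.
  apply: (@stab_slope p); first by rewrite groupM ?groupV.
  have [[Gf _] [Gg _]] := (stabP Cf, stabP Cg).
  by rewrite slopeM ?groupV // slopeV // sfg divff ?slope_neq0.
rewrite -(card_in_imset inj) -(cardC1 0%R); apply: eq_card => a.
rewrite !inE; apply/imsetP/idP => [[f _ ->]|/(stab_ex p)[f Cf <-]].
  exact: slope_neq0.
by exists f.
Qed.

(** A nontrivial [f] fixing [p] fixes no other point, so [f ^ g] can fix [p] only if [g] does. The
    bound on [#|F|] makes the stabiliser, of order [#|F|.-1], nontrivial. *)
Lemma stab_Frobenius p : #|F| > 2 -> [Frobenius G with complement stab p].
Proof.
move=> F3; apply/andP; split.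
  have [f Gf fE] := AGL1_exists 1%R (oner_neq0 F).
  apply: contraTneq Gf => <-; apply/stabP=> -[_]; rewrite fE mul1r => /eqP.
  by rewrite addrC -subr_eq0 addrK oner_eq0.
apply/normedTI_memJ_P; split; first 1 last.
- exact: subsetIl.
- move=> f g /setD1P[nf Cf] Gg; have [Gf fp] := stabP Cf.
  rewrite 2!inE conjg_eq1 nf /=; apply/idP/idP => [/stabP[_]|Cg]; last exact: groupJ.
  rewrite !permM => /(canRL (permK g)) fix'.
  have sf : slope f != 1%R by apply: contraNneq nf => /(stab_slope Cf) ->.
  apply/stabP; split=> //; have := slope_fix_uniq Gf sf fp fix'.
  by move/(canRL (permKV g)).
rewrite setD_eq0 subG1 trivg_card1 card_stab.
by case: #|F| F3 => [|[|[|]]].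
Qed.

(** Commutators have slope 1, so [H] is abelian; whatever commutes with a nontrivial [f] of [H]
    preserves the only fixed point of [f]. *)
Lemma sub_stab (H : {group {perm F}}) : H \subset G ->
  (forall f, f \in H -> slope f = 1%R -> f = 1) -> exists p, H \subset stab p.
Proof.
move=> sHG tiH; have [->|/trivgPn[f Hf nf]] := eqsVneq H 1.
  by exists 0%R; exact: sub1G.
have Gf := subsetP sHG f Hf.
have sf : slope f != 1%R by apply: contraNneq nf => /(tiH _ Hf) ->.
have [p fp] := slope_fix Gf sf.
exists p; apply/subsetP=> g Hg; have Gg := subsetP sHG g Hg.
apply/stabP; split=> //; apply: (slope_fix_uniq Gf sf fp).
have: [~ f, g] = 1.
  apply: tiH; first by rewrite groupR.
  rewrite commgEl conjgE !slopeM ?groupM ?groupV // !slopeV //.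
  by field; rewrite !slope_neq0.
by move/eqP/commgP/permP/(_ p); rewrite !permM fp.
Qed.

(** Identifies an abstract Frobenius kernel with the translations. Let [k] be nontrivial in [K] and
    [t] a nontrivial translation: [t] is conjugate to [k] if [k] is a translation, and otherwise
    [k * t] is, so [t] lies in [K]. The complement [L] then contains no nontrivial translation and
    lies in a cyclic point stabiliser; an element of [K] of slope other than 1 has a conjugate in
    that stabiliser, which centralises [L], against the regular action of [L] on [K]. *)
Lemma Frobenius_kernel_AGL1 (K : {group {perm F}}) :
  [Frobenius G with kernel K] -> forall f, f \in K = (f \in G) && (slope f == 1%R).
Proof.
case/existsP=> L frobG f; have [defG ntK ntL _ _] := Frobenius_context frobG.
have [nsKG sLG _ _ tiKL] := sdprod_context defG; have [sKG nKG] := andP nsKG.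
have KJ k h : k \in K -> h \in G -> k ^ h \in K.
  by move=> Kk Gh; rewrite memJ_norm // (subsetP nKG).
have sTK t : t \in G -> slope t = 1%R -> t \in K.
  move=> Gt st; have [->|nt] := eqVneq t 1; first exact: group1.
  have [k Kk nk] := trivgPn _ ntK; have Gk := subsetP sKG k Kk.
  have [sk|sk] := eqVneq (slope k) 1%R.
    by have [h Gh ->] := conj_translation Gk Gt sk st nk nt; exact: KJ.
  have [|h Gh eqk] := conj_slope Gk (groupM Gk Gt) sk.
    by rewrite slopeM // st mulr1.
  by rewrite -(groupMl _ Kk) eqk KJ.
apply/idP/andP => [Kf | [Gf /eqP]]; last exact: sTK.
have Gf := subsetP sKG f Kf; split=> //; apply/idPn => sf.
have [|p sLC] := sub_stab sLG.
  move=> g Lg sg; apply/set1gP; rewrite -tiKL inE Lg andbT.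
  by apply: sTK; rewrite ?(subsetP sLG).
have [x Lx nx] := trivgPn _ ntL.
have [g Cg sg] := stab_ex p (slope_neq0 f); have [Gg _] := stabP Cg.
have [h Gh defg] := conj_slope Gf Gg sf sg.
have: g \in 'C_K[x].
  rewrite inE defg KJ //= -defg; apply/cent1P.
  exact: (centsP (cyclic_abelian (stab_cyclic p))) (subsetP sLC x Lx).
rewrite (Frobenius_reg_ker frobG) ?inE ?nx // => /eqP g1.
by move: sf; rewrite -sg g1 slope1 eqxx.
Qed.

End Slope.

Arguments stabP {F p f}.

(** * Transversals and their enumeration *)

Section Transversals.

Lemma left_transversal_lcoset (gT : finGroupType) (C H : {group gT}) (A : {set gT}) :
    H \subset C -> A \subset C -> {in C, forall x, #|A :&: x *: H| = 1%N} ->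
  left_transversal C H A.
Proof.
move=> sHC sAC A1; apply/and3P; split=> //; last first.
  by apply/forall_inP=> _ /lcosetsP[x Cx ->]; rewrite A1.
apply/and3P; split.
- rewrite eqEsubset; apply/andP; split; last first.
    apply/subsetP=> x Cx; apply/bigcupP; exists (x *: H); last exact: lcoset_refl.
    by apply/lcosetsP; exists x.
  by apply/bigcupsP=> _ /lcosetsP[x Cx ->]; rewrite mul_subG ?sub1set.
- apply/trivIsetP=> _ _ /lcosetsP[x _ ->] /lcosetsP[y _ ->].
  apply: contraR => /pred0Pn[z /andP[/= xHz yHz]].
  by rewrite -(lcoset_eqP xHz) -(lcoset_eqP yHz).
- by apply/lcosetsP=> -[x _ /esym/setP/(_ x)]; rewrite lcoset_refl inE.
Qed.

(** Serves to index the transversal with its element of [H^#] at 0, the index that the union in the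
    perfect case leaves out. *)
Lemma enum_with_head (T : finType) (A : {set T}) (x0 : T) : x0 \in A ->
  exists a : nat -> T, [/\ [set a i | i : 'I_#|A|] = A, a 0%N = x0
    & forall (rT : finType) (B : T -> {set rT}),
        \bigcup_(1 <= i < #|A|) B (a i) = \bigcup_(x in A :\ x0) B x].
Proof.
move=> Ax0; pose e := enum (A :\ x0); exists (nth x0 (x0 :: e)).
have sA : #|A| = (size e).+1 by rewrite -cardE (cardsD1 x0) Ax0.
split=> // [|rT B]; last first.
  by rewrite sA big_add1 /= -(big_nth x0 xpredT B) big_enum.
apply/setP=> x; rewrite -[in RHS](setD1K Ax0) in_setU1 -(mem_enum (A :\ x0)) -in_cons.
apply/imsetP/(nthP x0) => [[i _ ->]|[i lti <-]].
  by exists i => //; rewrite -[size _]/(size e).+1 -sA.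
have ltiA : i < #|A| by rewrite sA.
by exists (Ordinal ltiA).
Qed.

End Transversals.

(** * Subgroup codes as conditions on left cosets *)

Section CayleySumCodes.

Variables (gT : finGroupType) (G H : {group gT}) (X : {set gT}).
Hypothesis X1 : 1 \notin X.

(** Left multiplication by [x] carries the neighbours of [x] in [H] to [X :&: x *: H]; the
    hypothesis absorbs the condition that adjacent vertices be distinct. *)
Lemma card_cayley_nbr x : {in H, forall y, x * y \in X -> x != y} ->
  #|[set y in H | cayley_sum X x y]| = #|X :&: x *: H|.
Proof.
move=> xX; rewrite -[LHS](card_imset _ (mulgI x)); apply: eq_card => z.
apply/imsetP/setIP => [[y]|[Xz /lcosetP[y Hy defz]]].
  by case/setIdP=> Hy /andP[_ Xxy] ->; split; rewrite ?mem_lcoset ?mulKg.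
rewrite defz in Xz; exists y => //.
by apply/setIdP; split=> //; apply/andP; split=> //; exact: xX.
Qed.

Lemma perfect_code_disjoint x :
  perfect_code G (cayley_sum X) H -> x \in H -> x \notin X.
Proof.
case/and3P=> _ /forall_inP/(_ 1 (group1 H))/forall_inP H0 _ Hx.
have:= H0 x Hx; rewrite /cayley_sum /= mul1g negb_and => /orP[|//].
by rewrite negbK => /eqP <-.
Qed.

Lemma perfect_code_lcoset x :
    perfect_code G (cayley_sum X) H -> x \in G -> x \notin H ->
  #|X :&: x *: H| = 1%N.
Proof.
case/and3P=> _ _ /forall_inP H1 Gx nHx; rewrite -card_cayley_nbr.
  by apply/eqP/H1; rewrite inE nHx.
by move=> y Hy _; apply: contraNneq nHx => ->.
Qed.

Lemma total_perfect_code_lcoset x :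
  total_perfect_code G (cayley_sum X) H -> x \in G -> #|X :&: x *: H| = 1%N.
Proof.
case/andP=> _ /forall_inP H1 Gx; have [Hx|nHx] := boolP (x \in H).
  (* The coset [H] is counted at the vertex 1, where distinctness follows from [1 \notin X]; at
     another [x] of [H], the square of [x] might lie in [X]. *)
  rewrite lcoset_id // -(lcoset_id (group1 H)) -card_cayley_nbr.
    by apply/eqP/H1; exact: group1.
  by move=> y Hy; rewrite mul1g; apply: contraTneq => <-.
rewrite -card_cayley_nbr; first by apply/eqP/H1.
by move=> y Hy _; apply: contraNneq nHx => ->.
Qed.

End CayleySumCodes.

(** * Normal subsets of the affine group *)

Section NormalSubsets.

Variables (F : finFieldType) (X : {set {perm F}}).
Notation G := (AGL1 F).
Hypotheses (nsXG : X <| G) (X1 : 1 \notin X).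
Implicit Types (f g k x : {perm F}) (p : F).

Lemma normal_memJ f g : f \in X -> g \in G -> f ^ g \in X.
Proof. by move=> Xf Gg; rewrite memJ_norm // (subsetP (normal_norm nsXG)). Qed.

Lemma normal_slope f g : f \in X -> slope f != 1%R -> g \in G ->
  slope g = slope f -> g \in X.
Proof.
move=> Xf sf Gg sg; have Gf := subsetP (normal_sub nsXG) f Xf.
by have [h Gh ->] := conj_slope Gf Gg sf sg; apply: normal_memJ.
Qed.

Lemma normal_translation f g : f \in X -> slope f = 1%R -> g \in G ->
  slope g = 1%R -> g != 1 -> g \in X.
Proof.
move=> Xf sf Gg sg ng; have Gf := subsetP (normal_sub nsXG) f Xf.
have nf : f != 1 by apply: contraNneq X1 => <-.
by have [h Gh ->] := conj_translation Gf Gg sf sg nf ng; apply: normal_memJ.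
Qed.

(** Every slope is attained in the stabiliser of [p], so each class outside [K] meets it. *)
Lemma bigcup_stab_class (K : {group {perm F}}) p :
    [Frobenius G with kernel K] ->
  X :\: K = \bigcup_(x in X :&: 'C_G[p | 'P]) x ^: G.
Proof.
move=> frobG; have inK := Frobenius_kernel_AGL1 frobG.
apply/setP=> g; apply/setDP/bigcupP => [[Xg nKg]|[f /setIP[Xf Cf] /imsetP[h Gh ->]]].
  have Gg := subsetP (normal_sub nsXG) g Xg; rewrite inK Gg /= in nKg.
  have [f Cf sf] := stab_ex p (slope_neq0 g); have [Gf _] := stabP Cf.
  exists f; first by rewrite inE Cf andbT (normal_slope Xg).
  by have [||h Gh ->] := conj_slope Gf Gg; rewrite ?sf //; exact: imset_f.
have [Gf _] := stabP Cf; split; first exact: normal_memJ.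
rewrite inK groupJ //= conjgE !slopeM ?groupM ?groupV // slopeV //.
rewrite mulrCA mulVf ?slope_neq0 // mulr1.
by apply: contraNneq X1 => /(stab_slope Cf) <-.
Qed.

End NormalSubsets.

(** * Intersections of the code and of [X] with the kernel *)

Section Codes.

Variables (F : finFieldType) (K : {group {perm F}}).
Notation G := (AGL1 F).
Hypothesis frobG : [Frobenius G with kernel K].

(** A Frobenius complement is nontrivial and meets [K] trivially. This excludes the field with two
    elements. *)
Lemma AGL1_Frobenius_slope : exists2 f, f \in G & slope f != 1%R.
Proof.
have inK := Frobenius_kernel_AGL1 frobG; have [L frobL] := existsP frobG.
have [defG _ ntL _ _] := Frobenius_context frobL.
have [_ sLG _ _ tiKL] := sdprod_context defG.
have [f Lf nf] := trivgPn _ ntL; have Gf := subsetP sLG f Lf.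
exists f => //; apply: contraNN nf => sf.
by apply/eqP/set1gP; rewrite -tiKL inE inK Gf sf.
Qed.

Lemma AGL1_Frobenius_card : #|F| > 2.
Proof.
have [f _ sf] := AGL1_Frobenius_slope.
have /card_uniqP/= <- : uniq [:: 0%R; 1%R; slope f].
  by rewrite /= !inE negb_or ![0%R == _]eq_sym oner_eq0 slope_neq0 eq_sym sf.
exact: max_card.
Qed.

(** Common to both parts, with [s = #|A|] the index of [H] in the stabiliser and [t = #|H|]. A
    cyclic group has one subgroup of each order, so [H] is generated by [c ^+ s]. *)
Lemma stab_transversal (H : {group {perm F}}) (p : F) (A : {set {perm F}}) a0 :
    H \subset 'C_G[p | 'P] -> A \subset 'C_G[p | 'P] -> a0 \in A -> a0 \in H^# ->
    {in 'C_G[p | 'P], forall x, #|A :&: x *: H| = 1%N} ->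
  exists (c : {perm F}) (s t : nat) (a : nat -> {perm F}),
    [/\ [Frobenius G with complement 'C_G[p | 'P]] /\ 'C_G[p | 'P] = <[c]>,
        [/\ 0 < s, 0 < t, #|F| - 1 = s * t & 1 < t]%N,
        left_transversal 'C_G[p | 'P] <[c ^+ s]> [set a i | i : 'I_s],
        a 0%N \in <[c ^+ s]>^#
      & \bigcup_(1 <= i < s) a i ^: G = \bigcup_(x in A :\ a0) x ^: G
        /\ a 0%N = a0].
Proof.
move=> sHC sAC Aa0 Ha0 A1; have trA := left_transversal_lcoset sHC sAC A1.
have cycC := stab_cyclic p; have [c defC] := cyclicP cycC.
have [a [defA a00 bigA]] := enum_with_head Aa0.
have cardA : #|A| = #|'C_G[p | 'P] : H| by rewrite (card_transversal trA) card_lcosets.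
have cardC : (#|H| * #|A| = #|F| - 1)%N by rewrite cardA Lagrange // card_stab subn1.
have defH : H :=: <[c ^+ #|A|]>.
  have scC : <[c ^+ #|A|]> \subset 'C_G[p | 'P] by rewrite defC cycleX.
  apply/eqP; rewrite (eq_subG_cyclic cycC sHC scC).
  have oc : #[c] = (#|H| * #|A|)%N by rewrite cardA Lagrange // orderE -defC.
  have A0 : 0 < #|A| by apply/card_gt0P; exists a0.
  by rewrite -orderE orderXdiv oc ?dvdn_mull // mulnK.
exists c, #|A|, #|H|, a; split=> //.
- by split; first exact: stab_Frobenius AGL1_Frobenius_card.
- split=> //; first by apply/card_gt0P; exists a0.
  + by rewrite mulnC cardC.
  + case/setD1P: Ha0 => na0 Ha0; rewrite cardG_gt1.
    by apply/trivgPn; exists a0.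
- by rewrite defA -defH.
- by rewrite a00 -defH.
- by split; first exact: (bigA _ (fun x => x ^: G)).
Qed.

Variable X : {set {perm F}}.
Hypotheses (nsXG : X <| G) (X1 : 1 \notin X).
Variable H : {group {perm F}}.
Hypothesis sHG : H \subset G.

Let inK := Frobenius_kernel_AGL1 frobG.
Let sKG : K \subset G.
Proof. by apply/subsetP=> k; rewrite inK => /andP[]. Qed.
Let slopeK k : k \in K -> slope k = 1%R.
Proof. by rewrite inK => /andP[_ /eqP]. Qed.
Let sXG := subsetP (normal_sub nsXG).

Lemma lcoset_uniq x y z : #|X :&: x *: H| = 1%N ->
  y \in X -> z \in X -> y \in x *: H -> z \in x *: H -> y = z.
Proof.
move/eqP/cards1P=> [w defw] Xy Xz xHy xHz.
have: y \in X :&: x *: H by rewrite inE Xy.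
have: z \in X :&: x *: H by rewrite inE Xz.
by rewrite defw => /set1P-> /set1P->.
Qed.

(* Multiplying an element of [X] outside [K] by a nontrivial element of
   [H :&: K] stays both in [X] and in the same left coset of [H]. *)
Lemma tiHK_slope_neq1 x : x \in X -> slope x != 1%R -> #|X :&: x *: H| = 1%N ->
  H :&: K = 1.
Proof.
move=> Xx sx xH1; apply/trivgP/subsetP=> k /setIP[Hk Kk].
have [Gx Gk] := (sXG Xx, subsetP sKG k Kk).
have Xxk : x * k \in X.
  apply: (normal_slope nsXG Xx) => //; first exact: groupM.
  by rewrite slopeM // (slopeK Kk) mulr1.
have := lcoset_uniq xH1 Xx Xxk (lcoset_refl _ _).
by rewrite mem_lcoset mulKg Hk -{1}[x]mulg1 => /(_ isT)/mulgI <-.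
Qed.

Lemma tiHK_sub_stab : H :&: K = 1 -> exists p, H \subset 'C_G[p | 'P].
Proof.
move=> tiHK; apply: sub_stab => // f Hf sf; apply/set1gP.
by rewrite -tiHK inE Hf inK (subsetP sHG) // sf eqxx.
Qed.

(** If [X] contains a translation it contains [K^#], which then avoids [H]. For the inclusion,
    [k *: H] contains some [k * h] in [X]; a slope of [h] other than 1 would put [h] itself in [X],
    so [h = 1]. *)
Lemma perfect_code_kernel : X != set0 -> perfect_code G (cayley_sum X) H ->
  H :&: K = 1 /\ K^# \subset X.
Proof.
move=> ntX codeH.
have XH1 := perfect_code_lcoset codeH; have XH0 := perfect_code_disjoint X1 codeH.
have nHX x : x \in X -> x \notin H by move=> Xx; apply/negP => /XH0; rewrite Xx.
have tiHK : H :&: K = 1.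
  have [x Xx] := set0Pn _ ntX.
  have [sx|sx] := eqVneq (slope x) 1%R; last first.
    by apply: (tiHK_slope_neq1 Xx sx); rewrite XH1 ?nHX ?sXG.
  apply/trivgP/subsetP=> k /setIP[Hk Kk]; apply: contraLR Hk; rewrite in_set1 => nk.
  apply/nHX/(normal_translation nsXG X1 Xx) => //; last exact: slopeK.
  exact: (subsetP sKG).
split=> //; apply/subsetP=> k /setD1P[nk Kk]; have Gk := subsetP sKG k Kk.
have nHk : k \notin H.
  by apply: contra nk => Hk; apply/eqP/set1gP; rewrite -tiHK inE Hk.
have /card_gt0P[x /setIP[Xkh /lcosetP[h Hh defkh]]] : 0 < #|X :&: k *: H|.
  by rewrite XH1.
rewrite {}defkh in Xkh; have Gh := subsetP sHG h Hh.
have skh : slope (k * h) = slope h by rewrite slopeM // (slopeK Kk) mul1r.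
have [sh|sh] := eqVneq (slope h) 1%R.
  have: h \in H :&: K by rewrite inE Hh inK Gh sh eqxx.
  by rewrite tiHK => /set1P h1; rewrite h1 mulg1 in Xkh.
have:= nHX h; rewrite Hh => /(_ (normal_slope nsXG Xkh _ Gh _)).
by rewrite skh => /(_ sh erefl).
Qed.

(** Let [a0] be the only element of [X] in [H]. If [X] met [K], it would contain [K^#], and for a
    suitable [k] in [K] both [k] and [k * a0] would be elements of [X] in [k *: H]. *)
Lemma total_perfect_code_kernel : total_perfect_code G (cayley_sum X) H ->
  H :&: K = 1 /\ X :&: K = set0.
Proof.
move=> codeH; have XH1 x Gx := @total_perfect_code_lcoset _ _ _ _ X1 x codeH Gx.
have /card_gt0P[a0 /setIP[Xa0]] : 0 < #|X :&: 1 *: H| by rewrite XH1 // group1.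
rewrite lcoset_id // => Ha0.
have XK0 : X :&: K = set0.
  apply/eqP/set0Pn=> -[x /setIP[Xx Kx]].
  have XK k : k \in K -> k != 1 -> k \in X.
    move=> Kk; apply: (normal_translation nsXG X1 Xx) => //; rewrite ?slopeK //.
    exact: (subsetP sKG).
  (* The translations by 1 and by [slope u] are distinct and nontrivial, so one of them differs from
     [a0]. *)
  have [k Kk /andP[nk nka]] : exists2 k, k \in K & (k != 1) && (k != a0).
    have [u _ su] := AGL1_Frobenius_slope.
    have [t1 Gt1 t1E] := AGL1_exists 1%R (oner_neq0 F).
    have [tu Gtu tuE] := AGL1_exists (slope u) (oner_neq0 F).
    have tK t b : t \in G -> (forall x, t x = 1%R * x + b)%R -> b != 0%R ->
        (t \in K) && (t != 1).
      move=> Gt tE nb; rewrite inK Gt (AGL1_slope tE) eqxx /=.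
      apply: contraNneq nb => t1'; have := tE 0%R.
      by rewrite t1' perm1 mulr0 add0r => <-.
    have /andP[Kt1 nt1] := tK _ _ Gt1 t1E (oner_neq0 F).
    have /andP[Ktu ntu] := tK _ _ Gtu tuE (slope_neq0 u).
    have [defa|nta] := eqVneq t1 a0; last by exists t1; rewrite ?nt1.
    exists tu => //; rewrite ntu -defa; apply: contra su => /eqP/permP/(_ 0%R).
    by rewrite t1E tuE mulr0 !add0r => ->.
  have Gk := subsetP sKG k Kk.
  have Xk := XK k Kk nk.
  have nHk : k \notin H.
    apply: contra nka => Hk; apply/eqP.
    by apply: (lcoset_uniq (XH1 1 (group1 _))); rewrite // lcoset_id.
  have Ga0 := sXG Xa0.
  have Xka : k * a0 \in X.
    have [sa|sa] := eqVneq (slope a0) 1%R.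
      apply: XK; first by rewrite groupM // inK Ga0 sa eqxx.
      by apply: contra nHk; rewrite -eq_invg_mul => /eqP ka; rewrite -groupV ka.
    apply: (normal_slope nsXG Xa0 sa); first exact: groupM.
    by rewrite slopeM // (slopeK Kk) mul1r.
  have:= lcoset_uniq (XH1 k Gk) Xk Xka (lcoset_refl _ _).
  rewrite mem_lcoset mulKg Ha0 -{1}[k]mulg1 => /(_ isT)/mulgI a01.
  by have:= X1; rewrite a01 Xa0.
split=> //; apply: (tiHK_slope_neq1 Xa0); last exact: XH1 (sXG Xa0).
apply/negP=> sa; have:= in_set0 a0.
by rewrite -XK0 inE Xa0 inK (sXG Xa0) sa.
Qed.

End Codes.

Theorem theorem5p14 (q : nat) (F : finFieldType) (hq : #|F| = q)
    (K : {group {perm F}}) (hK : [Frobenius AGL1 F with kernel K])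
    (X : {set {perm F}}) (hX : X <| AGL1 F) (hX1 : 1 \notin X) :
  (X != set0 ->
   (exists H : {group {perm F}},
      [/\ H \subset AGL1 F, H :!=: 1
        & perfect_code (AGL1 F) (cayley_sum X) H]) ->
   exists (C : {group {perm F}}) (c : {perm F}) (s t : nat)
          (a : nat -> {perm F}),
     [/\ [Frobenius AGL1 F with complement C] /\ C :=: <[c]>,
         [/\ 0 < s, 0 < t, q - 1 = s * t & 1 < t]%N,
         left_transversal C <[c ^+ s]> [set a i | i : 'I_s],
         a 0%N \in <[c ^+ s]> :\ 1
       & X = (\bigcup_(1 <= i < s) (a i ^: AGL1 F)) :|: (K :\ 1)])
  /\
  ((exists H : {group {perm F}},
      H \subset AGL1 F /\ total_perfect_code (AGL1 F) (cayley_sum X) H) ->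
   exists (C : {group {perm F}}) (c : {perm F}) (s t : nat)
          (a : nat -> {perm F}),
     [/\ [Frobenius AGL1 F with complement C] /\ C :=: <[c]>,
         [/\ 0 < s, 0 < t, q - 1 = s * t & 1 < t]%N,
         left_transversal C <[c ^+ s]> [set a i | i : 'I_s],
         a 0%N \in <[c ^+ s]> :\ 1
       & X = \bigcup_(0 <= i < s) (a i ^: AGL1 F)]).
Proof.
rewrite -{}hq.
split=> [ntX [H [sHG ntH codeH]]|[H [sHG codeH]]].
  have XH0 := perfect_code_disjoint hX1 codeH.
  have XH1 := perfect_code_lcoset codeH.
  have [tiHK sKX] := perfect_code_kernel hK hX hX1 sHG ntX codeH.
  have [p sHC] := tiHK_sub_stab hK sHG tiHK.
  have [a0 Ha0 na0] := trivgPn _ ntH.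
  (* [X] misses [H] but meets every other coset of [H] in the stabiliser once; [a0] represents the
     missing coset. *)
  pose A := a0 |: (X :&: 'C_(AGL1 F)[p | 'P]).
  have nAa0 : a0 \notin X :&: 'C_(AGL1 F)[p | 'P] by rewrite inE negb_and XH0.
  have [|||x Cx|c [s [t [a [frobC st_eq trA a0s [bigA _]]]]]] :=
      @stab_transversal F K hK H p A a0 sHC.
  - by rewrite subUset sub1set (subsetP sHC) //= subsetIr.
  - exact: setU11.
  - by rewrite !inE na0.
  - have sxC : x *: H \subset 'C_(AGL1 F)[p | 'P] by rewrite mul_subG ?sub1set.
    have AxH : A :&: x *: H = ([set a0] :&: x *: H) :|: (X :&: x *: H).
      by rewrite setIUl -setIA (setIidPr sxC).
    have [Hx|nHx] := boolP (x \in H).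
      rewrite AxH lcoset_id // (setIidPl _) ?sub1set //.
      rewrite (_ : X :&: H = set0) ?setU0 ?cards1 //.
      apply/eqP/set0Pn=> -[y /setIP[Xy Hy]].
      by have := XH0 y Hy; rewrite Xy.
    rewrite AxH (_ : [set a0] :&: x *: H = set0) ?set0U.
      by apply: XH1 => //; case/stabP: Cx.
    apply/eqP/set0Pn=> -[y /setIP[/set1P ->]].
    rewrite mem_lcoset (groupMr _ Ha0) groupV.
    by apply/negP.
  exists 'C_(AGL1 F)[p | 'P]%G, c, s, t, a; split=> //.
  rewrite bigA setU1K // -(bigcup_stab_class hX hX1 p hK).
  rewrite -{1}(setID X K) setUC; congr (_ :|: _).
  apply/setP=> k; rewrite in_setI in_setD1; apply/andP/andP => [[Xk Kk]|[nk Kk]].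
    by split=> //; apply: contraNneq hX1 => <-.
  by split=> //; apply: (subsetP sKX); rewrite !inE nk.
have XH1 := total_perfect_code_lcoset hX1 codeH.
have [tiHK XK0] := total_perfect_code_kernel hK hX hX1 codeH.
have [p sHC] := tiHK_sub_stab hK sHG tiHK.
have /card_gt0P[a0 /setIP[Xa0]] : 0 < #|X :&: 1 *: H| by rewrite XH1 // group1.
rewrite lcoset_id // => Ha0.
pose A := X :&: 'C_(AGL1 F)[p | 'P].
have Aa0 : a0 \in A by rewrite inE Xa0 (subsetP sHC).
have [||x Cx|c [s [t [a [frobC st_eq trA a0s [bigA a00]]]]]] :=
    @stab_transversal F K hK H p A a0 sHC _ Aa0.
- exact: subsetIr.
- by rewrite !inE Ha0 andbT; apply: contraNneq hX1 => <-.
- have sxC : x *: H \subset 'C_(AGL1 F)[p | 'P] by rewrite mul_subG ?sub1set.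
  by rewrite -setIA (setIidPr sxC) XH1 //; case/stabP: Cx.
exists 'C_(AGL1 F)[p | 'P]%G, c, s, t, a; split=> //.
have [s0 _ _ _] := st_eq.
(* Here [a0] lies in [X], so the class at index 0 is split off and joined to the others. *)
rewrite big_ltn // bigA a00 -(big_setD1 a0 Aa0) -(bigcup_stab_class hX hX1 p hK).
by rewrite -{1}(setID X K) XK0 set0U.
Qed.
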